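(* Let $f,g$ be analytic in $\mathbb{D}$ such that $f$ is convex (univalent) in $\mathbb{D}$ and $g\in S(f)$, and write $g(z)=\sum_{k=0}^\infty b_k z^k$ and $\Omega=f(\mathbb{D})$. Then the inequality $$|g(z)|+\sum_{k=1}^\infty |b_k|r^k\le |f(0)|+\operatorname{dist}(f(0),\partial\Omega)$$ holds for $|z|=r<r_f$ with $r_f=1/5$. The sharpness of $r_f$ is shown by the convex function $f(z)=z/(1-z)$ (that is, for this $f$ the number $1/5$ cannot be replaced by any larger number such that the inequality still holds for all $g\in S(f)$).
   Context: $\mathbb{D}=\{z\in\mathbb{C}:|z|<1\}$ is the open unit disk. For analytic $f$ in $\mathbb{D}$, $S(f)=\{g:\ g\prec f\}$, where $g\prec f$ ($g$ is subordinate to $f$) means that $g=f\circ\omega$ for some analytic $\omega:\mathbb{D}\to\mathbb{D}$ with $\omega(0)=0$. $\operatorname{dist}(f(0),\partial\Omega)$ is the Euclidean distance from the point $f(0)$ to the boundary $\partial\Omega$ of $\Omega$. Convex (univalent) means that $f$ is analytic and injective in $\mathbb{D}$ and $f(\mathbb{D})$ is a convex set. *)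

(* Defs.v *)
From Stdlib Require Import Reals.
From Coquelicot Require Import Coquelicot.

Open Scope R_scope.

Definition unit_disk (z : C) : Prop := Cmod z < 1.

(* Functions on the disk are total functions C -> C; only their values on
   [unit_disk] matter below.  Analytic means complex differentiable at every
   point of the open disk. *)
Definition analytic_in_disk (f : C -> C) : Prop :=
  forall z : C, unit_disk z -> ex_derive (K := C_AbsRing) (V := C_NormedModule) f z.

Definition disk_image (f : C -> C) (w : C) : Prop :=
  exists z : C, unit_disk z /\ f z = w.

Definition convex_set (A : C -> Prop) : Prop :=
  forall (x y : C) (t : R), A x -> A y -> 0 <= t <= 1 ->
    A (RtoC (1 - t) * x + RtoC t * y)%C.

Definition convex_univalent (f : C -> C) : Prop :=
  analytic_in_disk f /\
  (forall z1 z2 : C, unit_disk z1 -> unit_disk z2 -> f z1 = f z2 -> z1 = z2) /\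
  convex_set (disk_image f).

Definition subordinate (g f : C -> C) : Prop :=
  exists omega : C -> C,
    analytic_in_disk omega /\
    (forall z : C, unit_disk z -> unit_disk (omega z)) /\
    omega (RtoC 0) = RtoC 0 /\
    (forall z : C, unit_disk z -> g z = f (omega z)).

Definition power_series_in_disk (g : C -> C) (b : nat -> C) : Prop :=
  forall z : C, unit_disk z ->
    is_pseries (K := C_AbsRing) (V := C_NormedModule) b z (g z).

(* Points interior neither to A nor to its complement. *)
Definition boundary (A : C -> Prop) (w : C) : Prop :=
  ~ locally (T := C_UniformSpace) w A /\
  ~ locally (T := C_UniformSpace) w (fun x : C => ~ A x).

(* Extended-real valued, so that the distance to the empty set is +oo. *)
Definition dist_to (w : C) (A : C -> Prop) : Rbar :=
  Glb_Rbar (fun d : R => exists x : C, A x /\ d = Cmod (x - w)%C).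

(* The partial sums are nondecreasing for r >= 0, so this limit always exists in
   Rbar; it is +oo when the series diverges. *)
Definition majorant_tail (b : nat -> C) (r : R) : Rbar :=
  Lim_seq (fun n : nat => sum_n_m (fun k : nat => Cmod (b k) * r ^ k) 1 n).

Definition bohr_inequality (f g : C -> C) (b : nat -> C) (z : C) (r : R) : Prop :=
  Rbar_le
    (Rbar_plus (Finite (Cmod (g z))) (majorant_tail b r))
    (Rbar_plus (Finite (Cmod (f (RtoC 0))))
       (dist_to (f (RtoC 0)) (boundary (disk_image f)))).

Definition bohr_inequality_up_to (f : C -> C) (rho : R) : Prop :=
  forall (g : C -> C) (b : nat -> C),
    analytic_in_disk g -> subordinate g f -> power_series_in_disk g b ->
    forall (z : C) (r : R),
      unit_disk z -> Cmod z = r -> r < rho -> bohr_inequality f g b z r.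

(* Main.v *)
Require Import Defs.
From Stdlib Require Import Reals Lra Lia Classical.
From Coquelicot Require Import Coquelicot.

Open Scope R_scope.

(** Through a boundary point [w0] of the convex set [f(D)] passes a line having the
    set on one side ([supporting_half_plane]), so for some unit [u] the function
    [u * g], whose values are in [u * f(D)], satisfies [Re (u * g) <= Re (u * w0)] on
    the disk.

    A power series [h] with [Re h <= M] on the disk has [|c_k| <= 2 (M - Re c_0)]
    for [k >= 1] ([coefficient_bound_of_Re_le], a form of Caratheodory's
    inequality).  For [h = u * g], [M = Re (u * w0)] this reads
    [|b_k| <= 2 Re (u (w0 - f 0)) <= 2 |w0 - f 0|], because [b_0 = f 0].  Every
    boundary point is allowed, hence [|b_k| <= 2 d] with
    [d = dist (f 0, boundary)].

    It follows that the tail of the majorant series is at most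
    [2 d r / (1 - r)], which is [d / 2] at [r = 1/5].  The tail also bounds
    [|g z| - |f 0|], so it is counted twice and yields [|f 0| + d]
    ([convex_bohr_radius]).

    For [f z = z / (1 - z)] the image is the half-plane [Re w > -1/2], so [d] is
    at most [1/2].  With [g = f] and a real [z = r] the left-hand side equals
    [2 r / (1 - r)], which exceeds [1/2] as soon as [r > 1/5]
    ([half_plane_map_sharp]).

    The coefficient inequality comes from averaging [Re h] over a circle against a
    nonnegative trigonometric weight.  The average is discrete: it is taken over the
    [N]-th roots of unity and applied to the partial sum with [N] terms, on which
    Fourier inversion is an exact finite identity, and then [N] tends to infinity. *)

(** * Supporting half-planes of convex plane sets *)

Definition half_plane_at (A : C -> Prop) (w0 : C) (a b : R) : Prop :=
  forall w : C, A w -> a * (Re w - Re w0) + b * (Im w - Im w0) <= 0.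

(** Use coordinates [(x, y)] centred at [w0] with [p] on the positive [x]-axis, and
    suppose that the set misses the negative [x]-axis.  A segment of the set joining
    the lower to the upper half-plane must cross the axis at some [x >= 0], which says
    that the slope [x / y] of its lower end is at most that of its upper end.  A
    number [c] separating the two families of slopes gives the half-plane
    [x >= c y]. *)
Lemma half_plane_or_opposite_point (A : C -> Prop) (w0 p : C) :
  convex_set A -> p <> w0 ->
  (exists a b : R, 0 < a ^ 2 + b ^ 2 /\ half_plane_at A w0 a b) \/
  (exists l : R, 0 < l /\ A (w0 - RtoC l * (p - w0))%C).
Proof.
  intros Hconv Hne.
  destruct (classic (exists l : R, 0 < l /\ A (w0 - RtoC l * (p - w0))%C)) as [H|Hno];
    [right; exact H|left].
  destruct w0 as [x0 y0]; destruct p as [px' py'].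
  set (px := px' - x0); set (py := py' - y0).
  assert (Hp : 0 < px ^ 2 + py ^ 2).
  { destruct (Req_dec px 0) as [Ex|Ex]; [destruct (Req_dec py 0) as [Ey|Ey]|]; try nra.
    exfalso; apply Hne; unfold px, py in *; f_equal; lra. }
  pose (x := fun w : C => px * (Re w - x0) + py * (Im w - y0)).
  pose (y := fun w : C => px * (Im w - y0) - py * (Re w - x0)).
  assert (Hray : forall w, A w -> y w = 0 -> 0 <= x w).
  { intros w Hw Hy; apply Rnot_lt_le; intro Hx; apply Hno.
    exists (- x w / (px ^ 2 + py ^ 2)); split; [apply Rdiv_lt_0_compat; lra|].
    set (n := px ^ 2 + py ^ 2) in *.
    assert (Ex : Re w - x0 = x w * px / n).
    { apply (Rmult_eq_reg_r n); [|lra].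
      transitivity (x w * px - y w * py); [unfold x, y, n; ring|].
      rewrite Hy; field; lra. }
    assert (Ey : Im w - y0 = x w * py / n).
    { apply (Rmult_eq_reg_r n); [|lra].
      transitivity (x w * py + y w * px); [unfold x, y, n; ring|].
      rewrite Hy; field; lra. }
    replace ((x0, y0) - RtoC (- x w / n) * ((px', py') - (x0, y0)))%C with w; [exact Hw|].
    set (X := x w) in *; clearbody X; clear Hy.
    destruct w as [wx wy]; unfold Re, Im in Ex, Ey; simpl fst in *; simpl snd in *.
    unfold Cminus, Cmult, Copp, Cplus, RtoC; simpl fst; simpl snd.
    replace wx with (x0 + X * px / n) by lra.
    replace wy with (y0 + X * py / n) by lra.
    unfold px, py; f_equal; field; lra. }
  (* The crossing point of the segment is the convex combination with [y = 0]. *)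
  assert (Hcross : forall v w, A v -> A w -> 0 < y v -> y w < 0 -> x w / y w <= x v / y v).
  { intros v w Hv Hw Hyv Hyw.
    set (t := y v / (y v - y w)).
    assert (Ht : 0 <= t <= 1).
    { unfold t; split; [apply Rle_div_r; lra|apply Rle_div_l; lra]. }
    generalize (Hconv v w t Hv Hw Ht); intro Hz.
    apply Hray in Hz.
    - replace (x (RtoC (1 - t) * v + RtoC t * w)%C)
        with ((y v * x w - y w * x v) / (y v - y w)) in Hz.
      + apply Rle_div_r in Hz; [|lra].
        apply Rminus_le; replace (x w / y w - x v / y v)
          with ((y v * x w - y w * x v) / (y v * y w)) by (field; lra).
        assert (0 < - (y v * y w)) by nra.
        replace ((y v * x w - y w * x v) / (y v * y w))
          with (- ((y v * x w - y w * x v) / (- (y v * y w)))) by (field; lra).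
        assert (0 <= (y v * x w - y w * x v) / (- (y v * y w)))
          by (apply Rdiv_le_0_compat; lra).
        lra.
      + transitivity ((1 - t) * x v + t * x w); [unfold t; field; lra|].
        unfold x, Re, Im, Cplus, Cmult, RtoC; simpl; ring.
    - transitivity ((1 - t) * y v + t * y w); [|unfold t; field; lra].
      unfold y, Re, Im, Cplus, Cmult, RtoC; simpl; ring. }
  (* If one open side of the [x]-axis is missed, the axis itself bounds the half-plane. *)
  destruct (classic (exists v, A v /\ 0 < y v)) as [(v & Hv & Hyv)|Hup].
  2:{ exists (- py), px; split; [nra|].
      intros w Hw; apply Rnot_lt_le; intro H; apply Hup; exists w; split; [exact Hw|].
      unfold y; simpl Re in H; simpl Im in H; lra. }
  destruct (classic (exists v, A v /\ y v < 0)) as [(s & Hs & Hys)|Hdown].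
  2:{ exists py, (- px); split; [nra|].
      intros w Hw; apply Rnot_lt_le; intro H; apply Hdown; exists w; split; [exact Hw|].
      unfold y; simpl Re in H; simpl Im in H; lra. }
  destruct (completeness (fun q => exists w, A w /\ y w < 0 /\ q = x w / y w))
    as [c [Hub Hlub]].
  - exists (x v / y v); intros q (w & Hw & Hyw & ->); apply Hcross; assumption.
  - exists (x s / y s), s; repeat split; assumption.
  (* These are the coordinates of minus the functional [x - c y]. *)
  - exists (- px - c * py), (- py + c * px); split.
    + replace ((- px - c * py) ^ 2 + (- py + c * px) ^ 2)
        with ((px ^ 2 + py ^ 2) * (1 + c ^ 2)) by ring.
      apply Rmult_lt_0_compat; nra.
    + intros w Hw; simpl Re; simpl Im.
      assert (Hgoal : 0 <= x w - c * y w).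
      { destruct (Rtotal_order (y w) 0) as [Hy|[Hy|Hy]].
        - assert (Hle : x w / y w <= c).
          { apply Hub; exists w; repeat split; assumption. }
          replace (x w) with (x w / y w * y w) by (field; lra); nra.
        - rewrite Hy; generalize (Hray w Hw Hy); lra.
        - assert (Hle : c <= x w / y w).
          { apply Hlub; intros q (z & Hz & Hyz & ->); apply Hcross; assumption. }
          replace (x w) with (x w / y w * y w) by (field; lra); nra. }
      unfold x, y in Hgoal; unfold Re, Im in *; simpl fst in *; simpl snd in *; nra.
Qed.

Lemma convex_point_on_line (A : C -> Prop) (w0 p : C) (l t : R) :
  convex_set A -> A p -> 0 < l -> A (w0 - RtoC l * (p - w0))%C -> - l <= t <= 1 ->
  A (w0 + RtoC t * (p - w0))%C.
Proof.
  intros Hconv Hp Hl Hopp Ht.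
  replace (w0 + RtoC t * (p - w0))%C
    with (RtoC (1 - (t + l) / (1 + l)) * (w0 - RtoC l * (p - w0))
          + RtoC ((t + l) / (1 + l)) * p)%C.
  - apply Hconv; [exact Hopp|exact Hp|].
    split; [apply Rdiv_le_0_compat; lra|apply Rle_div_l; lra].
  - destruct w0 as [x0 y0]; destruct p as [px py].
    unfold Cminus, Cmult, Copp, Cplus, RtoC; simpl; f_equal; field; lra.
Qed.

(** Without such a half-plane, the set has two points [p], [q] that are linearly
    independent as seen from [w0], and by [half_plane_or_opposite_point] it also
    contains points opposite to each of them.  So [w0] is interior to a quadrilateral
    with vertices in the set. *)
Lemma supporting_functional (A : C -> Prop) (w0 : C) :
  convex_set A -> ~ locally (T := C_UniformSpace) w0 A ->
  exists a b : R, 0 < a ^ 2 + b ^ 2 /\ half_plane_at A w0 a b.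
Proof.
  intros Hconv Hint; apply NNPP; intro Hno; apply Hint; clear Hint.
  assert (Hpos : forall a b, 0 < a ^ 2 + b ^ 2 ->
    exists w, A w /\ 0 < a * (Re w - Re w0) + b * (Im w - Im w0)).
  { intros a b Hab; apply NNPP; intro H; apply Hno; exists a, b; split; [exact Hab|].
    intros w Hw; apply Rnot_lt_le; intro Hlt; apply H; exists w; split; assumption. }
  assert (Hopp : forall p, p <> w0 -> exists l, 0 < l /\ A (w0 - RtoC l * (p - w0))%C).
  { intros p Hp; destruct (half_plane_or_opposite_point A w0 p Hconv Hp) as [H|H];
      [contradiction|exact H]. }
  destruct (Hpos 1 0) as (p & Hp & Hpx); [lra|].
  assert (Hpx' : 0 < (- (Im p - Im w0)) ^ 2 + (Re p - Re w0) ^ 2).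
  { apply Rplus_le_lt_0_compat; [apply pow2_ge_0|apply pow_lt; lra]. }
  destruct (Hpos (- (Im p - Im w0)) (Re p - Re w0)) as (q & Hq & Hdet); [exact Hpx'|].
  destruct (Hopp p) as (l & Hl & Hpl); [intros ->; lra|].
  destruct (Hopp q) as (m & Hm & Hqm); [intros ->; lra|].
  set (px := Re p - Re w0) in *; set (py := Im p - Im w0) in *.
  set (qx := Re q - Re w0) in *; set (qy := Im q - Im w0) in *.
  set (D := px * qy - py * qx).
  assert (HD : 0 < D) by (unfold D; lra).
  (* Cramer's rule bounds the coordinates of [z] in the basis [p], [q] by [K / D] times
     its distance to [w0], which dictates the size of the neighbourhood. *)
  set (K := Rabs px + Rabs py + Rabs qx + Rabs qy + 1).
  assert (HK : 0 < K).
  { unfold K; generalize (Rabs_pos px) (Rabs_pos py) (Rabs_pos qx) (Rabs_pos qy); lra. }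
  set (s := Rmin 1 (Rmin l m)).
  assert (Hs : 0 < s /\ s <= 1 /\ s <= l /\ s <= m).
  { unfold s; generalize (Rmin_l 1 (Rmin l m)) (Rmin_r 1 (Rmin l m))
      (Rmin_l l m) (Rmin_r l m).
    assert (0 < Rmin 1 (Rmin l m)) by (repeat apply Rmin_glb_lt; lra); lra. }
  assert (He : 0 < s * D / (2 * K)) by (apply Rdiv_lt_0_compat; nra).
  exists (mkposreal _ He); intros z [Hzx Hzy].
  change (Rabs (Re z - Re w0) < s * D / (2 * K)) in Hzx.
  change (Rabs (Im z - Im w0) < s * D / (2 * K)) in Hzy.
  set (zx := Re z - Re w0) in *; set (zy := Im z - Im w0) in *.
  assert (Hcoef : forall u v, Rabs u + Rabs v <= K ->
    - s <= 2 * ((zx * u - zy * v) / D) <= s).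
  { intros u v Huv; apply Rabs_le_between.
    replace (2 * ((zx * u - zy * v) / D)) with ((2 * (zx * u - zy * v)) * / D)
      by (field; lra).
    rewrite Rabs_mult, Rabs_inv, (Rabs_pos_eq D) by lra.
    apply Rle_div_l; [lra|].
    rewrite Rabs_mult, (Rabs_pos_eq 2) by lra.
    assert (H1 : Rabs (zx * u - zy * v) <= s * D / (2 * K) * K).
    { apply Rle_trans with (Rabs (zx * u) + Rabs (zy * v)).
      - unfold Rminus; rewrite <- (Rabs_Ropp (zy * v)); apply Rabs_triang.
      - rewrite !Rabs_mult.
        generalize (Rabs_pos u) (Rabs_pos v); intros; nra. }
    replace (s * D / (2 * K) * K) with (s * D / 2) in H1 by (field; lra); lra. }
  assert (Ha : - s <= 2 * ((zx * qy - zy * qx) / D) <= s).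
  { apply Hcoef; unfold K; generalize (Rabs_pos px) (Rabs_pos py); lra. }
  assert (Hb : - s <= 2 * ((zx * - py - zy * - px) / D) <= s).
  { apply Hcoef; unfold K; rewrite !Rabs_Ropp;
      generalize (Rabs_pos qx) (Rabs_pos qy); lra. }
  set (ta := 2 * ((zx * qy - zy * qx) / D)) in *.
  set (tb := 2 * ((zx * - py - zy * - px) / D)) in *.
  (* [z] is the midpoint of a point on the line of [p] and a point on the line of [q],
     hence the factor 2 in [ta] and [tb]. *)
  replace z with (RtoC (1 - / 2) * (w0 + RtoC ta * (p - w0))
                  + RtoC (/ 2) * (w0 + RtoC tb * (q - w0)))%C.
  - apply Hconv; [| |lra].
    + apply convex_point_on_line with l; try assumption; lra.
    + apply convex_point_on_line with m; try assumption; lra.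
  - assert (Ex : Re z = Re w0 + / 2 * ta * px + / 2 * tb * qx).
    { transitivity (Re w0 + zx); [unfold zx; ring|].
      unfold ta, tb, D; field; unfold D in HD; lra. }
    assert (Ey : Im z = Im w0 + / 2 * ta * py + / 2 * tb * qy).
    { transitivity (Im w0 + zy); [unfold zy; ring|].
      unfold ta, tb, D; field; unfold D in HD; lra. }
    clearbody ta tb; clear Ha Hb Hcoef; unfold px, py, qx, qy in Ex, Ey.
    destruct z as [z1 z2]; destruct w0 as [x0 y0]; destruct p as [p1 p2]; destruct q as [q1 q2].
    unfold Re, Im in Ex, Ey; simpl fst in *; simpl snd in *.
    unfold Cminus, Cmult, Copp, Cplus, RtoC; simpl; f_equal; lra.
Qed.

(** The functional normalised to a unit complex number acting by multiplication, so
    that it can be applied to a power series coefficient by coefficient. *)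
Lemma supporting_half_plane (A : C -> Prop) (w0 : C) :
  convex_set A -> ~ locally (T := C_UniformSpace) w0 A ->
  exists u : C, Cmod u = 1 /\ forall w : C, A w -> Re (u * (w - w0))%C <= 0.
Proof.
  intros Hconv Hint.
  destruct (supporting_functional A w0 Hconv Hint) as (a & b & Hab & H).
  set (N := sqrt (a ^ 2 + b ^ 2)).
  assert (HN : 0 < N) by (apply sqrt_lt_R0; exact Hab).
  assert (HNN : N * N = a ^ 2 + b ^ 2) by (apply sqrt_sqrt; lra).
  exists (a / N, - b / N); split.
  - unfold Cmod; simpl fst; simpl snd.
    replace ((a / N) ^ 2 + (- b / N) ^ 2) with 1; [apply sqrt_1|].
    replace ((a / N) ^ 2 + (- b / N) ^ 2) with ((a ^ 2 + b ^ 2) / (N * N)) by (field; lra).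
    rewrite HNN; field; lra.
  - intros w Hw; generalize (H w Hw); intro Hle.
    replace (Re (Cmult (a / N, - b / N) (w - w0)))
      with (/ N * (a * (Re w - Re w0) + b * (Im w - Im w0))).
    + generalize (Rinv_0_lt_compat N HN); nra.
    + unfold Re, Im, Cmult, Cminus, Cplus, Copp; simpl; field; lra.
Qed.

(** * Roots of unity and coefficients of polynomials *)

Definition cis (t : R) : C := (cos t, sin t).

Lemma Cmod_cis (t : R) : Cmod (cis t) = 1.
Proof.
  unfold Cmod, cis; simpl fst; simpl snd.
  replace (cos t ^ 2 + sin t ^ 2) with 1.
  - exact sqrt_1.
  - generalize (sin2_cos2 t); unfold Rsqr; intro H; lra.
Qed.

Lemma cis_pow (t : R) (n : nat) : (cis t ^ n)%C = cis (INR n * t).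
Proof.
  induction n as [|n IH].
  - simpl; unfold cis; rewrite Rmult_0_l, cos_0, sin_0; reflexivity.
  - rewrite Cpow_S, IH, S_INR.
    replace ((INR n + 1) * t) with (t + INR n * t) by ring.
    unfold cis; rewrite cos_plus, sin_plus; unfold Cmult; simpl; f_equal; ring.
Qed.

Lemma cis_neq_1 (t : R) : 0 < t < 2 * PI -> cis t <> RtoC 1.
Proof.
  intros Ht E.
  assert (Hc : cos t = 1) by exact (f_equal fst E).
  assert (Hs : 0 < sin (t / 2)) by (apply sin_gt_0; lra).
  replace t with (2 * (t / 2)) in Hc by field.
  rewrite cos_2a_sin in Hc; nra.
Qed.

Lemma primitive_root_exists (p : nat) :
  exists zeta : C, Cmod zeta = 1 /\ (zeta ^ S p)%C = RtoC 1 /\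
    forall n : nat, (0 < n < S p)%nat -> (zeta ^ n)%C <> RtoC 1.
Proof.
  assert (HN : 0 < INR (S p)) by (apply lt_0_INR; lia).
  exists (cis (2 * PI / INR (S p))); split; [|split].
  - apply Cmod_cis.
  - rewrite cis_pow.
    replace (INR (S p) * (2 * PI / INR (S p))) with (2 * PI) by (field; lra).
    unfold cis; rewrite cos_2PI, sin_2PI; reflexivity.
  - intros n [Hn0 HnN]; rewrite cis_pow; apply cis_neq_1.
    apply lt_0_INR in Hn0; apply lt_INR in HnN.
    generalize PI_RGT_0; intro HPI.
    replace (INR n * (2 * PI / INR (S p))) with (2 * PI * (INR n / INR (S p)))
      by (field; lra).
    assert (0 < INR n / INR (S p)) by (apply Rdiv_lt_0_compat; lra).
    assert (INR n / INR (S p) < 1) by (apply Rlt_div_l; lra).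
    split; nra.
Qed.

Lemma geometric_sum (x : C) (n : nat) :
  ((x - RtoC 1) * sum_n (fun j => (x ^ j)%C) n)%C = (x ^ S n - RtoC 1)%C.
Proof.
  induction n as [|n IH].
  - rewrite sum_O; simpl; ring.
  - rewrite sum_Sn; change plus with Cplus.
    rewrite Cmult_plus_distr_l, IH; rewrite !Cpow_S; ring.
Qed.

Lemma sum_powers_root_of_unity (x : C) (p : nat) :
  (x ^ S p)%C = RtoC 1 -> x <> RtoC 1 -> sum_n (fun j => (x ^ j)%C) p = RtoC 0.
Proof.
  intros Hx Hne.
  generalize (geometric_sum x p); rewrite Hx; intro E.
  replace (RtoC 1 - RtoC 1)%C with (RtoC 0) in E by ring.
  destruct (Ceq_dec (sum_n (fun j => (x ^ j)%C) p) (RtoC 0)) as [H|H]; [exact H|].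
  exfalso; refine (Cmult_neq_0 _ _ _ H E).
  intro E1; apply Hne; replace x with (x - RtoC 1 + RtoC 1)%C by ring; rewrite E1; ring.
Qed.

Lemma sum_n_RtoC_1 (n : nat) : sum_n (fun _ => RtoC 1) n = RtoC (INR (S n)).
Proof.
  induction n as [|n IH].
  - rewrite sum_O; reflexivity.
  - rewrite sum_Sn, IH, (S_INR (S n)), RtoC_plus; reflexivity.
Qed.

Lemma sum_n_single (a : nat -> C) (n k : nat) :
  (k <= n)%nat -> (forall m, (m <= n)%nat -> m <> k -> a m = RtoC 0) ->
  sum_n a n = a k.
Proof.
  revert k; induction n as [|n IH]; intros k Hk Ha.
  - rewrite sum_O; f_equal; lia.
  - rewrite sum_Sn; change plus with Cplus.
    destruct (Nat.eq_dec k (S n)) as [->|Hne].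
    + replace (sum_n a n) with (RtoC 0); [apply Cplus_0_l|].
      symmetry; rewrite (sum_n_ext_loc _ (fun _ => RtoC 0)).
      * clear; induction n as [|n IH]; [apply sum_O|].
        rewrite sum_Sn, IH; apply Cplus_0_l.
      * intros m Hm; apply Ha; lia.
    + rewrite (IH k), (Ha (S n)); try lia; [apply Cplus_0_r|].
      intros m Hm; apply Ha; lia.
Qed.

Lemma Cmod_pow_1 (z : C) (n : nat) : Cmod z = 1 -> Cmod (z ^ n)%C = 1.
Proof. intro H; rewrite Cmod_pow, H; apply pow1. Qed.

(** Written with [Cpow] and the coefficient on the left, so that [ring] applies to its
    terms. *)
Definition partial_sum (a : nat -> C) (n : nat) (z : C) : C :=
  sum_n (fun m => (a m * z ^ m)%C) n.

(** The exponent [S p - k] stands for [-k].  Exchanging the sums leaves, for each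
    coefficient [a m], the sum of the powers of [zeta ^ (m - k)], which vanishes unless
    [m = k]. *)
Lemma discrete_fourier_inversion (zeta : C) (p k : nat) (a : nat -> C) :
  (zeta ^ S p)%C = RtoC 1 ->
  (forall n : nat, (0 < n < S p)%nat -> (zeta ^ n)%C <> RtoC 1) ->
  (k <= p)%nat ->
  sum_n (fun j => (partial_sum a p (zeta ^ j) * (zeta ^ j) ^ (S p - k))%C) p
  = (RtoC (INR (S p)) * a k)%C.
Proof.
  intros H1 Hprim Hk.
  transitivity (sum_n (fun m =>
    (a m * sum_n (fun j => ((zeta ^ (m + (S p - k))) ^ j)%C) p)%C) p).
  - rewrite (sum_n_ext _ (fun j => sum_n (fun m =>
      (a m * (zeta ^ (m + (S p - k))) ^ j)%C) p)).
    + rewrite sum_n_switch; apply sum_n_ext; intro m.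
      exact (sum_n_mult_l (K := C_Ring) (a m) _ p).
    + intro j; unfold partial_sum; rewrite Cmult_comm.
      change Cmult with (@mult C_Ring) at 1.
      rewrite <- (sum_n_mult_l (K := C_Ring)); apply sum_n_ext; intro m.
      change (@mult C_Ring) with Cmult.
      match goal with |- ?u = ?v => change (@eq C u v) end.
      rewrite <- !Cpow_mult_r.
      replace ((m + (S p - k)) * j)%nat with (j * m + j * (S p - k))%nat by lia.
      rewrite Cpow_add_r; ring.
  - rewrite (sum_n_single _ p k Hk).
    + replace (k + (S p - k))%nat with (S p) by lia; rewrite H1.
      rewrite (sum_n_ext _ (fun _ => RtoC 1)) by (intro; apply Cpow_1_l).
      rewrite sum_n_RtoC_1; apply Cmult_comm.
    + intros m Hm Hne.
      rewrite sum_powers_root_of_unity; [apply Cmult_0_r| |].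
      * rewrite <- Cpow_mult_r, Nat.mul_comm, Cpow_mult_r, H1; apply Cpow_1_l.
      * destruct (Nat.le_gt_cases k m) as [Hle|Hlt].
        -- replace (m + (S p - k))%nat with (S p + (m - k))%nat by lia.
           rewrite Cpow_add_r, H1, Cmult_1_l; apply Hprim; lia.
        -- apply Hprim; lia.
Qed.

Lemma Re_sum_n (a : nat -> C) (n : nat) : Re (sum_n a n) = sum_n (fun j => Re (a j)) n.
Proof.
  induction n as [|n IH]; [rewrite !sum_O; reflexivity|].
  rewrite !sum_Sn, <- IH; reflexivity.
Qed.

Lemma sum_n_le (a b : nat -> R) (n : nat) :
  (forall j, a j <= b j) -> sum_n a n <= sum_n b n.
Proof. intro H; apply sum_n_m_le; exact H. Qed.

Lemma sum_n_Cplus (a b : nat -> C) (n : nat) :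
  sum_n (fun j => (a j + b j)%C) n = (sum_n a n + sum_n b n)%C.
Proof. exact (sum_n_plus (G := C_AbelianMonoid) a b n). Qed.

Lemma sum_n_Cmult_l (c : C) (a : nat -> C) (n : nat) :
  sum_n (fun j => (c * a j)%C) n = (c * sum_n a n)%C.
Proof. exact (sum_n_mult_l (K := C_Ring) c a n). Qed.

Lemma Re_le_Cmod (z : C) : Re z <= Cmod z.
Proof. apply Rle_trans with (1 := Rle_abs _); apply re_le_Cmod. Qed.

(** Average [Re P * (1 + Re (u zeta^(jk)))] over the roots of unity [zeta^j].  The
    second factor is nonnegative with mean 1, so the average is at most [B].  Since
    [2 Re w = w + conj w], Fourier inversion evaluates it as
    [Re a_0 + Re (conj u * a_k) / 2 + Re (u * a_(p+1-k)) / 2], and [u] is chosen to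
    turn the middle term into [|a_k| / 2].  The last term appears because the
    exponents [k] and [k - (p+1)] agree on the roots of unity; it is a high
    coefficient, negligible for partial sums of a convergent series. *)
Lemma partial_sum_coefficient_bound (a : nat -> C) (p k : nat) (B : R) :
  (1 <= k <= p)%nat ->
  (forall z : C, Cmod z = 1 -> Re (partial_sum a p z) <= B) ->
  Cmod (a k) <= 2 * (B - Re (a 0%nat)) + Cmod (a (S p - k)%nat).
Proof.
  intros Hk HB.
  destruct (primitive_root_exists p) as (zeta & Hmod & H1 & Hprim).
  assert (HN : 0 < INR (S p)) by (apply lt_0_INR; lia).
  (* The phase of [a k], or any unit number if [a k = 0]. *)
  assert (Hu : exists u : C, Cmod u = 1 /\ (Cconj u * a k)%C = RtoC (Cmod (a k))).
  { destruct (Ceq_dec (a k) (RtoC 0)) as [E|Hne].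
    - exists (RtoC 1); rewrite E, Cmod_1, Cmod_0; split; [reflexivity|ring].
    - assert (Hpos : 0 < Cmod (a k)) by (apply Cmod_gt_0; exact Hne).
      assert (HneR : RtoC (Cmod (a k)) <> RtoC 0) by (intro E; apply RtoC_inj in E; lra).
      exists (a k / RtoC (Cmod (a k)))%C; split.
      + rewrite Cmod_div, Cmod_R, Rabs_pos_eq; try lra; [field; lra|exact HneR].
      + rewrite Cdiv_conj by exact HneR.
        replace (Cconj (RtoC (Cmod (a k)))) with (RtoC (Cmod (a k)))
          by (unfold Cconj, RtoC; simpl; f_equal; ring).
        transitivity (a k * Cconj (a k) / RtoC (Cmod (a k)))%C; [field; exact HneR|].
        rewrite <- Cmod2_conj, RtoC_pow; field; exact HneR. }
  destruct Hu as (u & Humod & Hu).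
  pose (w := fun j : nat => (u * (zeta ^ j) ^ k)%C).
  assert (Hw : forall j, Cmod (w j) = 1).
  { intro j; unfold w; rewrite Cmod_mult, Humod, !Cmod_pow, Hmod, !pow1; ring. }
  assert (Hper : forall j, ((zeta ^ j) ^ S p)%C = RtoC 1).
  { intro j; rewrite <- Cpow_mult_r, Nat.mul_comm, Cpow_mult_r, H1; apply Cpow_1_l. }
  assert (Hconj : forall j, Cconj (w j) = (Cconj u * (zeta ^ j) ^ (S p - k))%C).
  { intro j; unfold w; rewrite Cmult_conj; f_equal.
    assert (Hxk : Cmod ((zeta ^ j) ^ k) = 1) by (rewrite !Cmod_pow, Hmod, !pow1; ring).
    assert (Hinv : (Cconj ((zeta ^ j) ^ k) * (zeta ^ j) ^ k = RtoC 1)%C).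
    { rewrite Cmult_comm, <- Cmod2_conj, Hxk; simpl; f_equal; ring. }
    transitivity (Cconj ((zeta ^ j) ^ k) * ((zeta ^ j) ^ k * (zeta ^ j) ^ (S p - k)))%C.
    - rewrite <- Cpow_add_r; replace (k + (S p - k))%nat with (S p) by lia.
      rewrite Hper; ring.
    - rewrite Cmult_assoc, Hinv; ring. }
  assert (Hleft : sum_n (fun j => Re (partial_sum a p (zeta ^ j)) * (1 + Re (w j))) p
     = INR (S p) * (Re (a 0%nat) + Cmod (a k) / 2 + Re (u * a (S p - k)%nat) / 2)).
  { transitivity (Re (sum_n (fun j => (partial_sum a p (zeta ^ j) * (zeta ^ j) ^ (S p - 0)
        + ((Cconj u / 2) * (partial_sum a p (zeta ^ j) * (zeta ^ j) ^ (S p - k))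
        + (u / 2) * (partial_sum a p (zeta ^ j) * (zeta ^ j) ^ (S p - (S p - k)))))%C) p)).
    - rewrite Re_sum_n; apply sum_n_ext; intro j.
      (* The three sums are Fourier inversions at the indices [0], [k] and [S p - k]. *)
      replace (S p - (S p - k))%nat with k by lia.
      replace (S p - 0)%nat with (S p) by lia.
      rewrite Hper.
      transitivity (Re (partial_sum a p (zeta ^ j) * (RtoC 1 + (w j + Cconj (w j)) / 2))%C).
      + rewrite <- re_alt; unfold Cmult, Cplus, RtoC, Re; simpl; ring.
      + rewrite Hconj; unfold w; f_equal; field; intro E; apply RtoC_inj in E; lra.
    - rewrite !sum_n_Cplus, !sum_n_Cmult_l.
      rewrite !(discrete_fourier_inversion zeta p _ a H1 Hprim) by lia.
      replace (Cconj u / 2 * (INR (S p) * a k) + u / 2 * (INR (S p) * a (S p - k)%nat))%C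
        with (INR (S p) * ((Cconj u * a k) / 2 + (u * a (S p - k)%nat) / 2))%C
        by (field; intro E; apply RtoC_inj in E; lra).
      rewrite Hu, <- Cmult_plus_distr_l.
      unfold Cdiv; rewrite <- RtoC_inv by lra.
      unfold Cmult, Cplus, RtoC, Re; simpl; field. }
  assert (Hright : sum_n (fun j => B * (1 + Re (w j))) p = INR (S p) * B).
  { rewrite (sum_n_mult_l (K := R_Ring)).
    change (@mult R_Ring) with Rmult.
    transitivity (B * Re (sum_n (fun j => (RtoC 1 + u * (zeta ^ k) ^ j)%C) p)).
    - rewrite Re_sum_n; f_equal; apply sum_n_ext; intro j.
      unfold w; rewrite <- !Cpow_mult_r, (Nat.mul_comm j); reflexivity.
    - rewrite sum_n_Cplus, sum_n_Cmult_l, sum_n_RtoC_1, sum_powers_root_of_unity.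
      + change (B * Re (RtoC (INR (S p)) + u * RtoC 0)%C = INR (S p) * B).
        replace (RtoC (INR (S p)) + u * RtoC 0)%C with (RtoC (INR (S p))) by ring.
        unfold RtoC, Re; simpl fst; apply Rmult_comm.
      + rewrite <- Cpow_mult_r, Nat.mul_comm, Cpow_mult_r, H1; apply Cpow_1_l.
      + apply Hprim; lia. }
  assert (Hle : sum_n (fun j => Re (partial_sum a p (zeta ^ j)) * (1 + Re (w j))) p
     <= sum_n (fun j => B * (1 + Re (w j))) p).
  { apply sum_n_le; intro j; apply Rmult_le_compat_r.
    - generalize (re_le_Cmod (w j)); rewrite Hw; intro H; apply Rabs_le_between in H; lra.
    - apply HB, Cmod_pow_1, Hmod. }
  rewrite Hleft, Hright in Hle; apply Rmult_le_reg_l in Hle; [|exact HN].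
  assert (Hlast : - Re (u * a (S p - k)%nat)%C <= Cmod (a (S p - k)%nat)).
  { rewrite <- (Rmult_1_l (Cmod _)), <- Humod, <- Cmod_mult.
    generalize (re_le_Cmod (u * a (S p - k)%nat)); intro H.
    apply Rabs_le_between in H; lra. }
  lra.
Qed.

(** * Coefficients of power series with bounded real part *)

Lemma pow_n_Cpow (z : C) (n : nat) : pow_n (K := C_Ring) z n = (z ^ n)%C.
Proof. induction n as [|n IH]; simpl; [|rewrite IH]; reflexivity. Qed.

Lemma pseries_term (c : nat -> C) (z : C) (m : nat) :
  scal (K := C_AbsRing) (V := C_NormedModule) (pow_n (K := C_AbsRing) z m) (c m)
  = (c m * z ^ m)%C.
Proof.
  transitivity (pow_n (K := C_Ring) z m * c m)%C; [reflexivity|].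
  rewrite pow_n_Cpow; apply Cmult_comm.
Qed.

Lemma is_pseries_partial_sum (c : nat -> C) (z l : C) (eps : R) :
  is_pseries (K := C_AbsRing) (V := C_NormedModule) c z l -> 0 < eps ->
  exists N : nat, forall n : nat, (N <= n)%nat -> Cmod (partial_sum c n z - l)%C < eps.
Proof.
  intros H He.
  assert (Hloc : locally (T := C_NormedModule) l (fun w : C => Cmod (w - l)%C < eps)).
  { apply (locally_le_locally_norm (V := C_NormedModule)).
    exists (mkposreal eps He); intros y Hy; exact Hy. }
  destruct (H _ Hloc) as [N HN]; exists N; intros n Hn.
  replace (partial_sum c n z) with
    (sum_n (fun k => scal (K := C_AbsRing) (V := C_NormedModule)
              (pow_n (K := C_AbsRing) z k) (c k)) n); [exact (HN n Hn)|].
  apply sum_n_ext; intro m; apply pseries_term.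
Qed.

Lemma is_pseries_of_partial_sum (c : nat -> C) (z l : C) :
  (forall eps : R, 0 < eps ->
    exists N : nat, forall n : nat, (N <= n)%nat -> Cmod (partial_sum c n z - l)%C < eps) ->
  is_pseries (K := C_AbsRing) (V := C_NormedModule) c z l.
Proof.
  intros H P HP.
  apply (locally_norm_le_locally (V := C_NormedModule)) in HP.
  destruct HP as [eps Heps].
  destruct (H eps (cond_pos eps)) as [N HN]; exists N; intros n Hn.
  apply Heps.
  change (Cmod ((sum_n (fun k => scal (K := C_AbsRing) (V := C_NormedModule)
              (pow_n (K := C_AbsRing) z k) (c k)) n) - l)%C < eps).
  rewrite (sum_n_ext _ (fun m => (c m * z ^ m)%C)); [exact (HN n Hn)|].
  intro m; apply pseries_term.
Qed.

Lemma partial_sum_S (c : nat -> C) (n : nat) (z : C) :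
  partial_sum c (S n) z = (partial_sum c n z + c (S n) * z ^ S n)%C.
Proof. exact (sum_Sn (G := C_AbelianMonoid) _ n). Qed.

Lemma partial_sum_0 (c : nat -> C) (z : C) : partial_sum c 0 z = c 0%nat.
Proof. unfold partial_sum; rewrite sum_O; simpl; apply Cmult_1_r. Qed.

Lemma Cmod_minus_le (x y : C) : Cmod (x - y)%C <= Cmod x + Cmod y.
Proof. rewrite <- (Cmod_opp y); apply Cmod_triangle. Qed.

(** A term is the difference of two consecutive partial sums, and these converge. *)
Lemma is_pseries_terms_bounded (c : nat -> C) (z l : C) :
  is_pseries (K := C_AbsRing) (V := C_NormedModule) c z l ->
  exists K : R, forall n : nat, Cmod (c n * z ^ n)%C <= K.
Proof.
  intro H.
  destruct (maj_by_pos (fun n => Cmod (partial_sum c n z))) as [K [HK HKn]].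
  - exists (Cmod l); intros eps Heps.
    destruct (is_pseries_partial_sum c z l eps H Heps) as [N HN].
    exists N; intros n Hn.
    apply Rle_lt_trans with (2 := HN n Hn).
    exact (norm_triangle_inv (V := C_NormedModule) (partial_sum c n z) l).
  - exists (K + K); intro n.
    assert (HK' : forall j, Cmod (partial_sum c j z) <= K).
    { intro j; rewrite <- (Rabs_pos_eq _ (Cmod_ge_0 _)); apply HKn. }
    destruct n as [|n].
    + generalize (HK' 0%nat); rewrite partial_sum_0; simpl; rewrite Cmult_1_r; lra.
    + replace (c (S n) * z ^ S n)%C with (partial_sum c (S n) z - partial_sum c n z)%C
        by (rewrite partial_sum_S; ring).
      generalize (Cmod_minus_le (partial_sum c (S n) z) (partial_sum c n z)) (HK' n) (HK' (S n)); lra.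
Qed.

(** The bound depends on [z] only through [K] and [t]: this is what makes the truncation
    uniform on a circle. *)
Lemma partial_sum_tail_bound (c : nat -> C) (z l : C) (K t : R) (n : nat) :
  0 <= t < 1 -> (forall m, Cmod (c m * z ^ m)%C <= K * t ^ m) ->
  is_pseries (K := C_AbsRing) (V := C_NormedModule) c z l ->
  Cmod (partial_sum c n z - l)%C <= K * t ^ S n / (1 - t).
Proof.
  intros Ht Hc H.
  assert (HK : 0 <= K).
  { generalize (Hc 0%nat) (Cmod_ge_0 (c 0%nat * z ^ 0)%C); simpl; lra. }
  assert (Hq : forall q, Cmod (partial_sum c n z - partial_sum c (n + q) z)%C
    <= K * (t ^ S n - t ^ S (n + q)) / (1 - t)).
  { induction q as [|q IH].
    - rewrite Nat.add_0_r; replace (partial_sum c n z - partial_sum c n z)%C with (RtoC 0) by ring.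
      rewrite Cmod_0; apply Req_le; field; lra.
    - rewrite Nat.add_succ_r, partial_sum_S.
      replace (partial_sum c n z - (partial_sum c (n + q) z + c (S (n + q)) * z ^ S (n + q)))%C
        with (partial_sum c n z - partial_sum c (n + q) z - c (S (n + q)) * z ^ S (n + q))%C by ring.
      apply Rle_trans with (1 := Cmod_minus_le _ _).
      apply Rle_trans with (K * (t ^ S n - t ^ S (n + q)) / (1 - t) + K * t ^ S (n + q)).
      + apply Rplus_le_compat; [exact IH|apply Hc].
      + apply Req_le; simpl; field; lra. }
  apply le_epsilon; intros eps Heps.
  destruct (is_pseries_partial_sum c z l eps H Heps) as [N HN].
  replace (partial_sum c n z - l)%C
    with ((partial_sum c n z - partial_sum c (n + N) z) + (partial_sum c (n + N) z - l))%C by ring.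
  apply Rle_trans with (1 := Cmod_triangle _ _).
  apply Rplus_le_compat; [|apply Rlt_le, HN; lia].
  apply Rle_trans with (1 := Hq N).
  apply Rmult_le_compat_r; [apply Rlt_le, Rinv_0_lt_compat; lra|].
  apply Rmult_le_compat_l; [exact HK|].
  generalize (pow_le t (S (n + N)) (proj1 Ht)); lra.
Qed.

Lemma le_of_le_plus_geometric (x y L t : R) :
  0 <= t < 1 -> (forall q : nat, x <= y + L * t ^ q) -> x <= y.
Proof.
  intros Ht H.
  assert (Hlim : is_lim_seq (fun q => y + L * t ^ q) (y + L * 0)).
  { apply is_lim_seq_plus'; [apply is_lim_seq_const|].
    apply (is_lim_seq_scal_l _ L 0), is_lim_seq_geom; rewrite Rabs_pos_eq; lra. }
  replace y with (y + L * 0) by ring.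
  exact (is_lim_seq_le (fun _ => x) _ x (y + L * 0) H (is_lim_seq_const x) Hlim).
Qed.

Lemma le_of_radial_le (x y : R) (k : nat) :
  (forall r, 0 < r < 1 -> x * r ^ k <= y) -> x <= y.
Proof.
  intro H.
  assert (Hcont : continuity_pt (fun r => x * r ^ k) 1).
  { reg. }
  assert (Hr : is_lim_seq (fun n => 1 - (/ 2) ^ S n) 1).
  { replace (Finite 1) with (Finite (1 - 0)) by (f_equal; ring).
    apply is_lim_seq_minus'; [apply is_lim_seq_const|].
    apply (is_lim_seq_incr_1 (fun n => (/ 2) ^ n)), is_lim_seq_geom.
    rewrite Rabs_pos_eq; lra. }
  generalize (is_lim_seq_continuous _ _ _ Hcont Hr); intro Hlim.
  rewrite pow1, Rmult_1_r in Hlim.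
  refine (is_lim_seq_le _ (fun _ => y) x y _ Hlim (is_lim_seq_const y)).
  intro n; apply H.
  assert (0 < (/ 2) ^ S n) by (apply pow_lt; lra).
  assert ((/ 2) ^ S n <= / 2).
  { simpl; generalize (pow_incr (/ 2) 1 n); rewrite pow1; intro; nra. }
  lra.
Qed.

(** Fix [r < 1].  On the circle of radius [r] the partial sums converge uniformly and
    geometrically to [h], so their real parts are bounded by [M] up to a geometric
    error, and [partial_sum_coefficient_bound] applies to the coefficients
    [c_m r^m].  Let the degree, and afterwards [r], tend to their limits. *)
Lemma coefficient_bound_of_Re_le (h : C -> C) (c : nat -> C) (M : R) :
  power_series_in_disk h c -> (forall z, unit_disk z -> Re (h z) <= M) ->
  forall k : nat, (1 <= k)%nat -> Cmod (c k) <= 2 * (M - Re (c 0%nat)).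
Proof.
  intros Hser HM k Hk.
  apply (le_of_radial_le _ _ k); intros r Hr.
  (* An intermediate radius, where the terms are bounded; on the circle of radius [r]
     they then decay like the powers of [t = r / rho]. *)
  set (rho := (1 + r) / 2).
  assert (Hrho : r < rho < 1) by (unfold rho; lra).
  assert (Hdisk : forall x, 0 < x < 1 -> Cmod (RtoC x) = x).
  { intros x Hx; rewrite Cmod_R; apply Rabs_pos_eq; lra. }
  destruct (is_pseries_terms_bounded c (RtoC rho) (h (RtoC rho))) as [K HK].
  { apply Hser; unfold unit_disk; rewrite Hdisk; lra. }
  set (t := r / rho).
  assert (Ht : 0 <= t < 1).
  { unfold t; split; [apply Rdiv_le_0_compat; lra|apply Rlt_div_l; lra]. }
  assert (Hterm : forall z m, Cmod z = r -> Cmod (c m * z ^ m)%C <= K * t ^ m).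
  { intros z m Hz; generalize (HK m).
    rewrite !Cmod_mult, !Cmod_pow, Hz, Hdisk by lra; intro Hm.
    replace (r ^ m) with (rho ^ m * t ^ m).
    - rewrite <- Rmult_assoc; apply Rmult_le_compat_r; [apply pow_le; lra|exact Hm].
    - rewrite <- Rpow_mult_distr; f_equal; unfold t; field; lra. }
  pose (a := fun m => (c m * RtoC r ^ m)%C).
  assert (HrC : Cmod (RtoC r) = r) by (apply Hdisk; lra).
  assert (Ha : Cmod (a k) = Cmod (c k) * r ^ k)
    by (unfold a; rewrite Cmod_mult, Cmod_pow, HrC; reflexivity).
  rewrite <- Ha.
  assert (HKpos : 0 <= K).
  { generalize (HK 0%nat) (Cmod_ge_0 (c 0%nat * RtoC rho ^ 0)%C); lra. }
  apply (le_of_le_plus_geometric _ _ (2 * (K / (1 - t)) + K) t Ht); intro q.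
  assert (Hpoly : Cmod (a k) <= 2 * (M + K * t ^ S (k + q) / (1 - t) - Re (a 0%nat))
                   + Cmod (a (S (k + q) - k)%nat)).
  { apply partial_sum_coefficient_bound; [lia|].
    intros z Hz.
    assert (Hrz : Cmod (RtoC r * z)%C = r) by (rewrite Cmod_mult, HrC, Hz; ring).
    assert (Hin : unit_disk (RtoC r * z)%C) by (unfold unit_disk; lra).
    replace (partial_sum a (k + q) z) with (partial_sum c (k + q) (RtoC r * z)%C).
    - generalize (partial_sum_tail_bound c (RtoC r * z)%C (h (RtoC r * z)%C) K t (k + q) Ht
        (fun m => Hterm _ m Hrz) (Hser _ Hin)) (HM _ Hin)
        (Re_le_Cmod (partial_sum c (k + q) (RtoC r * z) - h (RtoC r * z))%C).
      replace (Re (partial_sum c (k + q) (RtoC r * z) - h (RtoC r * z))%C)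
        with (Re (partial_sum c (k + q) (RtoC r * z)%C) - Re (h (RtoC r * z)%C)) by reflexivity.
      lra.
    - apply sum_n_ext; intro m; unfold a; rewrite Cpow_mult_l; apply Cmult_assoc. }
  replace (S (k + q) - k)%nat with (S q) in Hpoly by lia.
  assert (Ha0 : a 0%nat = c 0%nat) by (unfold a; simpl; ring).
  rewrite Ha0 in Hpoly.
  assert (Hlast : Cmod (a (S q)) <= K * t ^ q).
  { apply Rle_trans with (1 := Hterm _ (S q) HrC).
    apply Rmult_le_compat_l; [exact HKpos|].
    simpl; generalize (pow_le t q (proj1 Ht)); intro; nra. }
  assert (Hpow : t ^ S (k + q) <= t ^ q).
  { rewrite <- (Rmult_1_l (t ^ q)).
    replace (S (k + q)) with (S k + q)%nat by lia; rewrite pow_add.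
    apply Rmult_le_compat_r; [apply pow_le; lra|].
    rewrite <- (pow1 (S k)); apply pow_incr; lra. }
  assert (Herr : K * t ^ S (k + q) / (1 - t) <= K / (1 - t) * t ^ q).
  { replace (K * t ^ S (k + q) / (1 - t)) with (K / (1 - t) * t ^ S (k + q)) by (field; lra).
    apply Rmult_le_compat_l; [apply Rdiv_le_0_compat; lra|exact Hpow]. }
  lra.
Qed.

(** * The inequality for convex functions *)

Lemma is_pseries_at_0 (c : nat -> C) (l : C) :
  is_pseries (K := C_AbsRing) (V := C_NormedModule) c (RtoC 0) l -> c 0%nat = l.
Proof.
  intro H.
  assert (Hle : Cmod (partial_sum c 0 (RtoC 0) - l)%C
                 <= Cmod (c 0%nat) * 0 ^ 1 / (1 - 0)).
  { apply partial_sum_tail_bound; [lra| |exact H].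
    intros [|m].
    - simpl; rewrite Cmult_1_r; lra.
    - rewrite Cpow_S, Cmult_0_l, Cmult_0_r, Cmod_0; simpl; lra. }
  rewrite partial_sum_0 in Hle.
  replace (Cmod (c 0%nat) * 0 ^ 1 / (1 - 0)) with 0 in Hle by field.
  replace (c 0%nat) with ((c 0%nat - l) + l)%C by ring.
  rewrite (Cmod_eq_0 (c 0%nat - l)%C); [ring|].
  generalize (Cmod_ge_0 (c 0%nat - l)%C); lra.
Qed.

Lemma unit_disk_0 : unit_disk (RtoC 0).
Proof. unfold unit_disk; rewrite Cmod_0; lra. Qed.

Lemma subordinate_value_at_0 (f g : C -> C) (b : nat -> C) :
  subordinate g f -> power_series_in_disk g b -> b 0%nat = f (RtoC 0).
Proof.
  intros (om & _ & _ & Hom0 & Hg) Hb.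
  rewrite (is_pseries_at_0 b (g (RtoC 0)) (Hb _ unit_disk_0)).
  rewrite Hg, Hom0 by exact unit_disk_0; reflexivity.
Qed.

(** The coefficient inequality for [u * g], whose values lie in the half-plane supporting
    the image of [f] at [w0]. *)
Lemma subordinate_coefficient_bound (f g : C -> C) (b : nat -> C) (w0 : C) :
  convex_set (disk_image f) -> subordinate g f -> power_series_in_disk g b ->
  boundary (disk_image f) w0 ->
  forall k : nat, (1 <= k)%nat -> Cmod (b k) <= 2 * Cmod (w0 - f (RtoC 0))%C.
Proof.
  intros Hconv Hsub Hb [Hw0 _] k Hk.
  rewrite <- (subordinate_value_at_0 f g b Hsub Hb).
  destruct (supporting_half_plane _ w0 Hconv Hw0) as (u & Hu & Hhalf).
  destruct Hsub as (om & _ & Hom & _ & Hg).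
  assert (Hbound : Cmod (u * b k)%C <= 2 * (Re (u * w0)%C - Re (u * b 0%nat)%C)).
  { apply (coefficient_bound_of_Re_le (fun z => (u * g z)%C) (fun k => (u * b k)%C));
      [| |exact Hk].
    - intros z Hz; apply (is_pseries_scal (V := C_NormedModule)); [apply Cmult_comm|].
      exact (Hb z Hz).
    - intros z Hz; apply Rminus_le.
      replace (Re (u * g z)%C - Re (u * w0)%C) with (Re (u * (g z - w0))%C)
        by (unfold Re, Cmult, Cminus, Cplus, Copp; simpl; ring).
      apply Hhalf; exists (om z); split; [apply Hom; exact Hz|symmetry; apply Hg; exact Hz]. }
  rewrite Cmod_mult, Hu, Rmult_1_l in Hbound.
  apply Rle_trans with (1 := Hbound); apply Rmult_le_compat_l; [lra|].
  replace (Re (u * w0)%C - Re (u * b 0%nat)%C) with (Re (u * (w0 - b 0%nat))%C)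
    by (unfold Re, Cmult, Cminus, Cplus, Copp; simpl; ring).
  apply Rle_trans with (1 := Re_le_Cmod _); rewrite Cmod_mult, Hu; lra.
Qed.

Lemma majorant_partial_sum_bound (b : nat -> C) (L r : R) (n : nat) :
  0 <= r < 1 -> (forall k, (1 <= k)%nat -> Cmod (b k) <= L) ->
  sum_n_m (fun k => Cmod (b k) * r ^ k) 1 n <= L * (r / (1 - r)).
Proof.
  intros Hr Hb.
  assert (HL : 0 <= L) by (apply Rle_trans with (1 := Cmod_ge_0 (b 1%nat)); auto).
  apply Rle_trans with (L * ((r - r ^ S n) / (1 - r))).
  - induction n as [|n IH].
    + rewrite sum_n_m_zero by lia; change (@zero _) with 0; apply Req_le; field; lra.
    + rewrite sum_n_Sm by lia; change plus with Rplus.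
      apply Rle_trans with (L * ((r - r ^ S n) / (1 - r)) + L * r ^ S n).
      * apply Rplus_le_compat; [exact IH|].
        apply Rmult_le_compat_r; [apply pow_le; lra|apply Hb; lia].
      * apply Req_le; simpl; field; lra.
  - apply Rmult_le_compat_l; [exact HL|].
    apply Rmult_le_compat_r; [apply Rlt_le, Rinv_0_lt_compat; lra|].
    generalize (pow_le r (S n) (proj1 Hr)); lra.
Qed.

Lemma Cmod_partial_sum_le (b : nat -> C) (z : C) (n : nat) :
  Cmod (partial_sum b n z)
  <= Cmod (b 0%nat) + sum_n_m (fun k => Cmod (b k) * Cmod z ^ k) 1 n.
Proof.
  induction n as [|n IH].
  - rewrite partial_sum_0, sum_n_m_zero by lia; change (@zero _) with 0; lra.
  - rewrite partial_sum_S, sum_n_Sm by lia; change plus with Rplus.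
    apply Rle_trans with (1 := Cmod_triangle _ _).
    rewrite Cmod_mult, Cmod_pow; lra.
Qed.

Lemma bohr_inequality_of_coefficient_bound (f g : C -> C) (b : nat -> C) (z : C) (d : R) :
  power_series_in_disk g b -> b 0%nat = f (RtoC 0) ->
  (forall k, (1 <= k)%nat -> Cmod (b k) <= 2 * d) -> Cmod z < 1 / 5 ->
  Rbar_le (Rbar_plus (Finite (Cmod (g z))) (majorant_tail b (Cmod z)))
          (Rbar_plus (Finite (Cmod (f (RtoC 0)))) (Finite d)).
Proof.
  intros Hser Hb0 Hb Hz.
  set (r := Cmod z).
  assert (Hr : 0 <= r < 1) by (split; [apply Cmod_ge_0|unfold r; lra]).
  assert (Hd : 0 <= d) by (generalize (Hb 1%nat (le_n _)) (Cmod_ge_0 (b 1%nat)); lra).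
  assert (Hsum : forall n, sum_n_m (fun k => Cmod (b k) * r ^ k) 1 n <= d / 2).
  { intro n; apply Rle_trans with (1 := majorant_partial_sum_bound b (2 * d) r n Hr Hb).
    assert (r / (1 - r) <= 1 / 4).
    { apply Rle_div_l; [lra|]; unfold r; lra. }
    nra. }
  assert (Hg : Cmod (g z) <= Cmod (f (RtoC 0)) + d / 2).
  { apply le_epsilon; intros eps Heps.
    assert (Hin : unit_disk z) by (unfold unit_disk; lra).
    destruct (is_pseries_partial_sum b z (g z) eps (Hser z Hin) Heps) as [N HN].
    generalize (HN N (le_n _)) (Cmod_partial_sum_le b z N) (Hsum N)
      (Cmod_minus_le (partial_sum b N z) (partial_sum b N z - g z)%C).
    replace (partial_sum b N z - (partial_sum b N z - g z))%C with (g z) by ring.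
    rewrite Hb0; fold r; lra. }
  apply Rbar_le_trans with
    (Rbar_plus (Finite (Cmod (f (RtoC 0)) + d / 2)) (Finite (d / 2))).
  - apply Rbar_plus_le_compat; [exact Hg|].
    rewrite <- (Lim_seq_const (d / 2)).
    apply Lim_seq_le_loc; exists 0%nat; intros n _; apply Hsum.
  - simpl; lra.
Qed.

(** Half of each [|b_k|] is a lower bound of the distances to the boundary points,
    therefore of their infimum; if there are no boundary points the right-hand side is
    infinite. *)
Lemma convex_bohr_radius (f : C -> C) :
  convex_set (disk_image f) -> bohr_inequality_up_to f (1 / 5).
Proof.
  intros Hconv g b _ Hsub Hb z r Hz <- Hr; unfold bohr_inequality.
  pose (E := fun d : R => exists x : C,
    boundary (disk_image f) x /\ d = Cmod (x - f (RtoC 0))%C).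
  destruct (Glb_Rbar_correct E) as [_ Hglb].
  fold (dist_to (f (RtoC 0)) (boundary (disk_image f))) in Hglb.
  assert (Hcoef : forall k, (1 <= k)%nat ->
    Rbar_le (Finite (Cmod (b k) / 2)) (dist_to (f (RtoC 0)) (boundary (disk_image f)))).
  { intros k Hk; apply Hglb; intros d (w0 & Hw0 & ->); simpl.
    generalize (subordinate_coefficient_bound f g b w0 Hconv Hsub Hb Hw0 k Hk); lra. }
  destruct (dist_to (f (RtoC 0)) (boundary (disk_image f))) as [d| |].
  - apply bohr_inequality_of_coefficient_bound; try assumption.
    + exact (subordinate_value_at_0 f g b Hsub Hb).
    + intros k Hk; generalize (Hcoef k Hk); simpl; lra.
  - simpl; destruct (Rbar_plus _ _); exact I.
  - destruct (Hcoef 1%nat (le_n _)).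
Qed.

(** * Sharpness: the half-plane map *)

Definition half_plane_map (z : C) : C := (z / (RtoC 1 - z))%C.

Lemma unit_disk_one_minus_neq_0 (z : C) : unit_disk z -> (RtoC 1 - z)%C <> RtoC 0.
Proof.
  intros Hz E; unfold unit_disk in Hz.
  replace z with (RtoC 1 - (RtoC 1 - z))%C in Hz by ring.
  rewrite E in Hz; replace (RtoC 1 - RtoC 0)%C with (RtoC 1) in Hz by ring.
  rewrite Cmod_1 in Hz; lra.
Qed.

Lemma half_plane_map_one_plus (z : C) :
  unit_disk z -> (RtoC 1 + half_plane_map z = / (RtoC 1 - z))%C.
Proof. intro Hz; unfold half_plane_map; field; apply unit_disk_one_minus_neq_0, Hz. Qed.

(** The inverse is [w / (1 + w)]: this gives injectivity, and the image as the set
    where [|w| < |1 + w|]. *)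
Lemma half_plane_map_inv (z : C) :
  unit_disk z -> z = (half_plane_map z / (RtoC 1 + half_plane_map z))%C.
Proof.
  intro Hz; rewrite half_plane_map_one_plus by exact Hz; unfold half_plane_map.
  generalize (unit_disk_one_minus_neq_0 z Hz); intro Hne.
  field; exact Hne.
Qed.

(** Both sides say that [w] is closer to [0] than to [-1]. *)
Lemma Cmod_lt_one_plus (w : C) : Cmod w < Cmod (RtoC 1 + w)%C <-> - (1 / 2) < Re w.
Proof.
  assert (E : Cmod (RtoC 1 + w)%C ^ 2 - Cmod w ^ 2 = 1 + 2 * Re w).
  { rewrite !Cmod2_alt; unfold Re, Im, Cplus, RtoC; simpl; ring. }
  generalize (Cmod_ge_0 w) (Cmod_ge_0 (RtoC 1 + w)%C); intros H1 H2.
  split; intro H; nra.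
Qed.

Lemma half_plane_map_image (w : C) :
  disk_image half_plane_map w <-> - (1 / 2) < Re w.
Proof.
  rewrite <- Cmod_lt_one_plus; split.
  - intros (z & Hz & <-).
    assert (Hne : (RtoC 1 - z)%C <> RtoC 0) by (apply unit_disk_one_minus_neq_0, Hz).
    rewrite half_plane_map_one_plus by exact Hz; unfold half_plane_map, unit_disk in *.
    rewrite Cmod_div, Cmod_inv by exact Hne.
    apply Cmod_gt_0 in Hne; apply Rinv_0_lt_compat in Hne; unfold Rdiv; nra.
  - intro H.
    assert (Hpos : 0 < Cmod (RtoC 1 + w)%C) by (generalize (Cmod_ge_0 w); lra).
    assert (Hne : (RtoC 1 + w)%C <> RtoC 0) by (apply Cmod_gt_0; exact Hpos).
    exists (w / (RtoC 1 + w))%C; split.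
    + unfold unit_disk; rewrite Cmod_div by exact Hne; apply Rlt_div_l; lra.
    + unfold half_plane_map; field; split; [exact Hne|].
      replace (RtoC 1 + w - w)%C with (RtoC 1) by ring.
      intro E; apply RtoC_inj in E; lra.
Qed.

(** The error of the linear approximation is exactly
    [(y - x)^2 / ((1 - x)^2 (1 - y))]. *)
Lemma half_plane_map_derivable (x : C) :
  unit_disk x ->
  ex_derive (K := C_AbsRing) (V := C_NormedModule) half_plane_map x.
Proof.
  intro Hx; generalize (unit_disk_one_minus_neq_0 x Hx); intro Hne.
  set (l := (/ ((RtoC 1 - x) * (RtoC 1 - x)))%C).
  exists l; split; [apply is_linear_scal_l|].
  intros x' Hx'.
  rewrite <- (is_filter_lim_locally_unique (V := AbsRing_NormedModule C_AbsRing) _ _ Hx'); clear x' Hx'.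
  intros eps; set (m := Cmod (RtoC 1 - x)%C).
  assert (Hm : 0 < m) by (apply Cmod_gt_0; exact Hne).
  (* The first bound keeps [|1 - y|] above [m / 2], the second makes the error small. *)
  set (delta := Rmin (m / 2) (eps * m ^ 3 / 2)).
  assert (Hdelta : 0 < delta).
  { apply Rmin_glb_lt; [lra|].
    generalize (cond_pos eps) (pow_lt m 3 Hm); intros; nra. }
  exists (mkposreal delta Hdelta); intros y Hy.
  change (Cmod (y - x)%C < delta) in Hy.
  change (Cmod (half_plane_map y - half_plane_map x - (y - x) * l)%C <= eps * Cmod (y - x)%C).
  assert (H1 : delta <= m / 2) by apply Rmin_l.
  assert (H2 : delta <= eps * m ^ 3 / 2) by apply Rmin_r.
  assert (Hy1 : m / 2 <= Cmod (RtoC 1 - y)%C).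
  { generalize (Cmod_triangle (RtoC 1 - y)%C (y - x)%C).
    replace (RtoC 1 - y + (y - x))%C with (RtoC 1 - x)%C by ring; fold m; lra. }
  assert (Hyne : (RtoC 1 - y)%C <> RtoC 0) by (apply Cmod_gt_0; lra).
  replace (half_plane_map y - half_plane_map x - (y - x) * l)%C
    with ((y - x) * ((y - x) * (/ (RtoC 1 - x) * / (RtoC 1 - x) * / (RtoC 1 - y))))%C
    by (unfold half_plane_map, l; field; split; assumption).
  rewrite !Cmod_mult, !Cmod_inv by assumption; fold m.
  rewrite (Rmult_comm eps); apply Rmult_le_compat_l; [apply Cmod_ge_0|].
  assert (Hinv : / Cmod (RtoC 1 - y)%C <= / (m / 2)) by (apply Rinv_le_contravar; lra).
  assert (Him : 0 < / m) by (apply Rinv_0_lt_compat; exact Hm).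
  apply Rle_trans with (delta * (/ m * / m * / (m / 2))).
  - apply Rmult_le_compat; [apply Cmod_ge_0| |lra|].
    + repeat apply Rmult_le_pos; try lra; apply Rlt_le, Rinv_0_lt_compat; lra.
    + apply Rmult_le_compat_l; [nra|exact Hinv].
  - apply Rle_trans with (eps * m ^ 3 / 2 * (/ m * / m * / (m / 2))).
    + apply Rmult_le_compat_r; [|exact H2].
      repeat apply Rmult_le_pos; try lra; apply Rlt_le, Rinv_0_lt_compat; lra.
    + apply Req_le; field; lra.
Qed.

Lemma half_plane_map_convex_univalent : convex_univalent half_plane_map.
Proof.
  split; [exact half_plane_map_derivable|split].
  - intros z1 z2 H1 H2 E.
    rewrite (half_plane_map_inv z1 H1), (half_plane_map_inv z2 H2), E; reflexivity.
  - intros x y t Hx Hy Ht; apply half_plane_map_image in Hx; apply half_plane_map_image in Hy.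
    apply half_plane_map_image.
    replace (Re (RtoC (1 - t) * x + RtoC t * y)%C) with ((1 - t) * Re x + t * Re y)
      by (unfold Re, Cplus, Cmult, RtoC; simpl; ring).
    destruct (Rle_lt_dec (Re x) (Re y)) as [Hle|Hle].
    + assert (0 <= t * (Re y - Re x)) by (apply Rmult_le_pos; lra); lra.
    + assert (0 <= (1 - t) * (Re x - Re y)) by (apply Rmult_le_pos; lra); lra.
Qed.

(** The boundary point [-1/2] realises the bound. *)
Lemma half_plane_map_dist :
  Rbar_le (dist_to (half_plane_map (RtoC 0)) (boundary (disk_image half_plane_map)))
          (Finite (1 / 2)).
Proof.
  destruct (Glb_Rbar_correct (fun d : R => exists x : C,
    boundary (disk_image half_plane_map) x /\ d = Cmod (x - half_plane_map (RtoC 0))%C))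
    as [Hlb _].
  apply Hlb; exists (RtoC (- (1 / 2))); split; [split|].
  - intro H; apply locally_singleton, half_plane_map_image in H; simpl in H; lra.
  - intros [eps Heps].
    apply (Heps (RtoC (- (1 / 2) + eps / 2))).
    + generalize (cond_pos eps); intro Hpos.
      split; [change (Rabs (- (1 / 2) + eps / 2 - - (1 / 2)) < eps)
             |change (Rabs (0 - 0) < eps)];
        apply Rabs_def1; lra.
    + apply half_plane_map_image; generalize (cond_pos eps); simpl; lra.
  - unfold half_plane_map.
    replace (RtoC (- (1 / 2)) - RtoC 0 / (RtoC 1 - RtoC 0))%C with (RtoC (- (1 / 2))).
    + rewrite Cmod_R, Rabs_left; lra.
    + unfold Cdiv; rewrite Cmult_0_l; ring.
Qed.

Definition geometric_coefficients (k : nat) : C :=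
  match k with 0%nat => RtoC 0 | S _ => RtoC 1 end.

Lemma half_plane_map_power_series :
  power_series_in_disk half_plane_map geometric_coefficients.
Proof.
  intros z Hz; generalize (unit_disk_one_minus_neq_0 z Hz); intro Hne.
  assert (Hsum : forall n,
    (partial_sum geometric_coefficients n z - half_plane_map z = - (z ^ S n / (RtoC 1 - z)))%C).
  { induction n as [|n IH].
    - rewrite partial_sum_0; unfold half_plane_map; simpl; field; exact Hne.
    - replace (partial_sum geometric_coefficients (S n) z - half_plane_map z)%C
        with (partial_sum geometric_coefficients n z - half_plane_map z + z ^ S n)%C
        by (rewrite partial_sum_S; simpl; ring).
      rewrite IH; simpl; field; exact Hne. }
  apply is_pseries_of_partial_sum; intros eps Heps.
  assert (Hm : 0 < Cmod (RtoC 1 - z)%C) by (apply Cmod_gt_0; exact Hne).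
  destruct (pow_lt_1_zero (Cmod z)) with (y := eps * Cmod (RtoC 1 - z)%C) as [N HN].
  - rewrite Rabs_pos_eq; [exact Hz|apply Cmod_ge_0].
  - apply Rmult_lt_0_compat; assumption.
  - exists N; intros n Hn.
    rewrite Hsum, Cmod_opp, Cmod_div, Cmod_pow by exact Hne.
    apply Rlt_div_l; [exact Hm|].
    apply Rle_lt_trans with (1 := Rle_abs _); apply HN; lia.
Qed.

Lemma geometric_majorant_tail (r : R) :
  0 <= r < 1 -> majorant_tail geometric_coefficients r = Finite (r / (1 - r)).
Proof.
  intro Hr; apply is_lim_seq_unique.
  apply is_lim_seq_ext with (fun n => (r - r ^ S n) * / (1 - r)).
  - induction n as [|n IH].
    + rewrite sum_n_m_zero by lia; change (@zero _) with 0; simpl; field; lra.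
    + rewrite sum_n_Sm, <- IH by lia; change plus with Rplus.
      simpl; rewrite Cmod_1; field; lra.
  - replace (Finite (r / (1 - r))) with (Finite ((r - 0) * / (1 - r)))
      by (f_equal; field; lra).
    apply (is_lim_seq_scal_r _ (/ (1 - r)) (r - 0)), is_lim_seq_minus';
      [apply is_lim_seq_const|].
    apply (is_lim_seq_incr_1 (fun n => r ^ n)), is_lim_seq_geom; rewrite Rabs_pos_eq; lra.
Qed.

Lemma analytic_in_disk_id : analytic_in_disk (fun z => z).
Proof.
  intros x _; exists (RtoC 1); split; [apply is_linear_scal_l|].
  intros x' _ eps; exists eps; intros y _.
  change (Cmod (y - x' - (y - x') * RtoC 1)%C <= eps * Cmod (y - x')%C).
  replace (y - x' - (y - x') * RtoC 1)%C with (RtoC 0) by ring.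
  rewrite Cmod_0; apply Rmult_le_pos; [apply Rlt_le, cond_pos|apply Cmod_ge_0].
Qed.

Lemma subordinate_refl (f : C -> C) : subordinate f f.
Proof.
  exists (fun z => z); repeat split; auto.
  exact analytic_in_disk_id.
Qed.

Lemma half_plane_map_sharp (rho : R) :
  1 / 5 < rho -> ~ bohr_inequality_up_to half_plane_map rho.
Proof.
  intros Hrho H.
  (* Any radius strictly between [1/5] and the smaller of [rho] and [1] would do. *)
  set (r := Rmin ((1 / 5 + rho) / 2) (1 / 2)).
  assert (Hr : 1 / 5 < r /\ r < rho /\ r <= 1 / 2).
  { unfold r; generalize (Rmin_l ((1 / 5 + rho) / 2) (1 / 2))
      (Rmin_r ((1 / 5 + rho) / 2) (1 / 2)).
    assert (1 / 5 < Rmin ((1 / 5 + rho) / 2) (1 / 2)) by (apply Rmin_glb_lt; lra); lra. }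
  assert (HrC : Cmod (RtoC r) = r) by (rewrite Cmod_R, Rabs_pos_eq; lra).
  assert (Hin : unit_disk (RtoC r)) by (unfold unit_disk; lra).
  specialize (H half_plane_map geometric_coefficients half_plane_map_derivable
    (subordinate_refl _) half_plane_map_power_series (RtoC r) r Hin HrC
    (proj1 (proj2 Hr))).
  unfold bohr_inequality in H.
  rewrite geometric_majorant_tail in H by lra.
  assert (H1 : Cmod (half_plane_map (RtoC r)) = r / (1 - r)).
  { unfold half_plane_map; rewrite Cmod_div by (apply unit_disk_one_minus_neq_0, Hin).
    rewrite HrC, <- RtoC_minus, Cmod_R, Rabs_pos_eq by lra; reflexivity. }
  assert (H0 : Cmod (half_plane_map (RtoC 0)) = 0).
  { unfold half_plane_map, Cdiv; rewrite Cmult_0_l; apply Cmod_0. }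
  rewrite H1, H0 in H.
  assert (Hle : Rbar_le (Finite (r / (1 - r) + r / (1 - r))) (Finite (0 + 1 / 2))).
  { apply Rbar_le_trans with (1 := H).
    apply (Rbar_plus_le_compat 0 0 _ (1 / 2)); [apply Rbar_le_refl|exact half_plane_map_dist]. }
  simpl in Hle.
  assert (1 / 4 < r / (1 - r)) by (apply (Rlt_div_r (1 / 4) r (1 - r)); lra).
  lra.
Qed.

Theorem theorem8 :
  (forall f : C -> C,
     convex_univalent f -> bohr_inequality_up_to f (1 / 5)) /\
  (convex_univalent (fun z : C => (z / (RtoC 1 - z))%C) /\
   forall rho : R, 1 / 5 < rho ->
     ~ bohr_inequality_up_to (fun z : C => (z / (RtoC 1 - z))%C) rho).
Proof.
  split; [|split].
  - intros f (_ & _ & Hconv); exact (convex_bohr_radius f Hconv).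
  - exact half_plane_map_convex_univalent.
  - exact half_plane_map_sharp.
Qed.
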